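(* Consider the linear model $\mathbf{y} = \boldsymbol{\Phi}\boldsymbol{\theta}_\circ + \boldsymbol{\varepsilon}$, where $\boldsymbol{\Phi}\in\mathbb{R}^{n\times d}$ is a known matrix, $\boldsymbol{\theta}_\circ\in\mathbb{R}^d$ is an unknown parameter vector, and $\boldsymbol{\varepsilon}$ is a zero-mean random vector in $\mathbb{R}^n$ with covariance matrix $\mathbf{V}_\circ\succeq\mathbf{0}$. For $\mathbf{V}\succeq\mathbf{0}$ ($n\times n$) define the estimator $$\widehat{\boldsymbol{\theta}}(\mathbf{V}) = \operatorname*{arg\,min}_{\boldsymbol{\theta}\in\mathbb{R}^d}\ \|\mathbf{y}-\boldsymbol{\Phi}\boldsymbol{\theta}\|_{\mathbf{V}^\dagger}^2\quad\text{subject to}\quad \mathbf{y}-\boldsymbol{\Phi}\boldsymbol{\theta}\in\mathcal{R}(\mathbf{V}).$$ If $\boldsymbol{\Phi}$ has full column rank, then among all linear unbiased estimators of $\boldsymbol{\theta}_\circ$, the minimum mean-squared error $\mathrm{MSE}(\boldsymbol{\theta}_\circ)$ is attained by $\widehat{\boldsymbol{\theta}}(\alpha\mathbf{V}_\circ)$, for any $\alpha>0$.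
   Context: $\mathbf{X}^\dagger$ is the Moore-Penrose pseudoinverse and $\mathcal{R}(\mathbf{M})$ is the range (column space) of $\mathbf{M}$. For $\mathbf{W}\succeq\mathbf{0}$ (symmetric positive semi-definite), $\|\mathbf{X}\|_{\mathbf{W}}=\sqrt{\operatorname{tr}\{\mathbf{X}^\top\mathbf{W}\mathbf{X}\}}$. A linear estimator is one of the form $\widehat{\boldsymbol{\theta}}=\mathbf{K}\mathbf{y}$ with $\mathbf{K}$ a $d\times n$ matrix independent of $\mathbf{y}$; it is unbiased if its expectation equals $\boldsymbol{\theta}_\circ$ for every $\boldsymbol{\theta}_\circ\in\mathbb{R}^d$. The mean-squared error is $\mathrm{MSE}(\boldsymbol{\theta}_\circ)=\mathbb{E}[\|\boldsymbol{\theta}_\circ-\widehat{\boldsymbol{\theta}}\|_2^2]$, with expectation over $\boldsymbol{\varepsilon}$. The estimator $\widehat{\boldsymbol{\theta}}(\alpha\mathbf{V}_\circ)$ is understood for data $\mathbf{y}$ generated by the model (i.e. it is defined almost surely). *)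

(* Defs.v *)
From HB Require Import structures.
From mathcomp Require Import all_boot all_order all_algebra.
From mathcomp Require Import all_classical all_reals all_analysis.

Set Implicit Arguments.
Unset Strict Implicit.
Unset Printing Implicit Defensive.

Import Order.TTheory GRing.Theory Num.Theory.

Local Open Scope classical_set_scope.
Local Open Scope ring_scope.

Section LinearAlgebra.
Context {R : realType}.

Definition psd n (V : 'M[R]_n) : Prop :=
  V^T = V /\ forall x : 'cV[R]_n, 0 <= (x^T *m V *m x) 0 0.

Definition mxrange m n (M : 'M[R]_(m, n)) : set 'cV[R]_m :=
  range (fun x : 'cV[R]_n => M *m x).

Definition penrose m n (A : 'M[R]_(m, n)) (X : 'M[R]_(n, m)) : Prop :=
  [/\ A *m X *m A = A, X *m A *m X = X,
      (A *m X)^T = A *m X & (X *m A)^T = X *m A].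

(* Not mathcomp's [pinvmx], which is only a partial inverse and does not make
   the two projections symmetric. *)
Definition mppinv m n (A : 'M[R]_(m, n)) : 'M[R]_(n, m) :=
  xget 0 [set X | penrose A X].

Lemma gram_unit m n (C : 'M[R]_(m, n)) : row_full C -> C^T *m C \in unitmx.
Proof.
move=> Cfull; rewrite -row_free_unit -kermx_eq0.
apply/rowV0P => v /sub_kermxP vCC.
have vC : v *m C^T = 0.
  have /matrixP/(_ 0 0) : (v *m C^T) *m (v *m C^T)^T = 0.
    by rewrite trmx_mul trmxK mulmxA -(mulmxA v) vCC mul0mx.
  rewrite !mxE => /eqP; rewrite psumr_eq0 => [/allP h|i _]; last first.
    by rewrite [X in _ * X]mxE -expr2 sqr_ge0.
  apply/rowP => j; have := h j (mem_index_enum j).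
  by rewrite [X in _ * X]mxE -expr2 sqrf_eq0 => /eqP ->; rewrite !mxE.
apply/eqP; rewrite -(mulmx_free_eq0 v (B := C^T)) ?vC //.
by rewrite /row_free mxrank_tr.
Qed.

Lemma penrose_exists m n (A : 'M[R]_(m, n)) : exists X, penrose A X.
Proof.
have := mulmx_base A; have := row_base_free A; have := col_base_full A.
move: (col_base A) (row_base A); move: (\rank A) => r C B Cfull Bfree /esym AE.
have uC : C^T *m C \in unitmx by exact: gram_unit.
have uB : B *m B^T \in unitmx.
  rewrite -{1}[B]trmxK; apply: gram_unit.
  by rewrite /row_full mxrank_tr; exact: Bfree.
pose P := invmx (C^T *m C) *m C^T; pose Q := B^T *m invmx (B *m B^T).
have PC : P *m C = 1%:M by rewrite /P -mulmxA mulVmx.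
have BQ : B *m Q = 1%:M by rewrite /Q mulmxA mulmxV.
have AX : A *m (Q *m P) = C *m P.
  by rewrite AE mulmxA -(mulmxA C) BQ mulmx1.
have XA : (Q *m P) *m A = Q *m B.
  by rewrite AE mulmxA -(mulmxA Q) PC mulmx1.
exists (Q *m P); split.
- by rewrite AX AE mulmxA -(mulmxA C) PC mulmx1.
- by rewrite XA mulmxA -(mulmxA Q) BQ mulmx1.
- by rewrite AX /P !trmx_mul trmxK trmx_inv trmx_mul trmxK mulmxA.
- by rewrite XA /Q !trmx_mul trmxK trmx_inv trmx_mul trmxK mulmxA.
Qed.

Lemma mppinvP m n (A : 'M[R]_(m, n)) : penrose A (mppinv A).
Proof. exact: xgetPex (penrose_exists A). Qed.

Definition wnorm n m (W : 'M[R]_n) (X : 'M[R]_(n, m)) : R :=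
  Num.sqrt (\tr (X^T *m W *m X)).

(* The Euclidean norm; the library norm `|x| on matrices is the sup norm. *)
Definition norm2 n (x : 'cV[R]_n) : R := Num.sqrt (\sum_i x i 0 ^+ 2).

End LinearAlgebra.

Section Estimators.
Context {R : realType} {n d : nat}.
Variable Phi : 'M[R]_(n, d).

Definition feasible (V : 'M[R]_n) (y : 'cV[R]_n) : set 'cV[R]_d :=
  [set theta | mxrange V (y - Phi *m theta)].

Definition wls_argmin (V : 'M[R]_n) (y : 'cV[R]_n) : set 'cV[R]_d :=
  [set theta | feasible V y theta /\
    forall theta', feasible V y theta' ->
      wnorm (mppinv V) (y - Phi *m theta) ^+ 2 <=
      wnorm (mppinv V) (y - Phi *m theta') ^+ 2].

(* The default value 0 is only returned when there is no minimizer, e.g. when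
   no theta is feasible. *)
Definition wls (V : 'M[R]_n) (y : 'cV[R]_n) : 'cV[R]_d :=
  xget 0 (wls_argmin V y).

Context {disp : measure_display} {T : measurableType disp}.
Variables (P : probability T R) (eps : 'I_n -> {RV P >-> R}).

Definition observation (theta0 : 'cV[R]_d) (w : T) : 'cV[R]_n :=
  Phi *m theta0 + \col_i eps i w.

Definition unbiased (est : 'cV[R]_n -> 'cV[R]_d) : Prop :=
  forall (theta0 : 'cV[R]_d) (i : 'I_d),
    ('E_P[fun w => (est (observation theta0 w) i 0)%R] = (theta0 i 0)%R%:E)%E.

Definition mse (est : 'cV[R]_n -> 'cV[R]_d) (theta0 : 'cV[R]_d) : \bar R :=
  ('E_P[fun w => (norm2 (theta0 - est (observation theta0 w)) ^+ 2)%R])%E.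

End Estimators.

(* Main.v *)
Require Import Defs.
From mathcomp Require Import all_boot all_order all_algebra.
From mathcomp Require Import all_classical all_reals all_analysis.
From mathcomp Require Import ring measurable_realfun.

Set Implicit Arguments.
Unset Strict Implicit.
Unset Printing Implicit Defensive.

Import Order.TTheory GRing.Theory Num.Theory.

Local Open Scope classical_set_scope.
Local Open Scope ring_scope.

(** Write [V] for the noise covariance.  Minimizing [tr (K V K^T)] subject to
    [K Phi = 1] has the stationarity condition [K V = S Phi^T] for some
    multiplier [S]; call such a [(K, S)] a KKT pair.  The estimator of
    the theorem is almost surely [K y] for any such pair, by the following
    facts.

    - Existence: the two equations read
      [(K, -S) [V Phi; Phi^T 0] = (0, 1)].  If [(x, a)] is in the kernel of
      this block matrix, then [V x + Phi a = 0] and [Phi^T x = 0], so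
      [x^T V x = 0], so [V x = 0] because [V] is positive semi-definite, and
      [a = 0] because [Phi] is injective; hence [(0, 1)] annihilates the
      kernel, which is solvability.

    - Optimality among unbiased estimators: unbiasedness of [K' y] means
      [K' Phi = 1], and its mean-squared error is [tr (K' V K'^T)].  With
      [D = K' - K] we have [D Phi = 0], the cross terms
      [K V D^T = S (D Phi)^T] vanish, and [tr (D V D^T) >= 0]
      ([kkt_trace_min]).

    - Identification with the constrained least squares: since
      [V V^+ V = V], the objective at a residual [V z] is [z^T V z].  If the
      noise is [V e], the residual of [K y] is [V z] with [Phi^T z = 0]; any
      other feasible residual differs from it by a vector in the range of
      [Phi], which is orthogonal to [z], so Pythagoras makes [K y] the unique
      minimizer ([wls_argmin_kkt]).  The same [K] serves every multiple
      [alpha V], because [(K, alpha S)] is a KKT pair for it.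

    - The noise lies in the range of [V] almost surely, because its image under
      a matrix [C^T] with [V C = 0] has second moment
      [tr (C^T V C) = 0] ([noise_range_ae]).

    On the remaining null event the least squares estimator is still a
    measurable function of the noise ([wls_kktE]), so that it has the
    mean-squared error of [K y] ([mse_wls]). *)

(** * Positive semi-definite quadratic forms *)

Lemma col_mul (R : pzSemiRingType) m n p (j : 'I_p)
    (A : 'M[R]_(m, n)) (B : 'M[R]_(n, p)) : col j (A *m B) = A *m col j B.
Proof. by rewrite !colE mulmxA. Qed.

Section QuadraticForm.
Context {R : realType}.

Definition qform n (V : 'M[R]_n) (x : 'cV[R]_n) : R := (x^T *m V *m x) 0 0.

Lemma qformD n (V : 'M[R]_n) (x y : 'cV[R]_n) : V^T = V ->
  qform V (x + y) = qform V x + qform V y + (x^T *m (V *m y)) 0 0 *+ 2.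
Proof.
move=> Vsym; have yVx : (y^T *m V *m x) 0 0 = (x^T *m (V *m y)) 0 0.
  have -> : y^T *m V *m x = (x^T *m (V *m y))^T.
    by rewrite !trmx_mul trmxK Vsym.
  by rewrite mxE.
have entryD (A B : 'M[R]_1) : (A + B) 0 0 = A 0 0 + B 0 0 by rewrite mxE.
rewrite /qform [(x + y)^T]linearD /= !mulmxDl !mulmxDr !entryD yVx.
rewrite -(mulmxA _ V y).
by ring.
Qed.

Lemma qformZ n (V : 'M[R]_n) (a : R) (x : 'cV[R]_n) :
  qform V (a *: x) = a ^+ 2 * qform V x.
Proof.
rewrite /qform [(a *: x)^T]linearZ /= -!scalemxAl -scalemxAr scalerA mxE.
by rewrite expr2.
Qed.

Lemma dotmx_eq0 n (x : 'cV[R]_n) : (x^T *m x) 0 0 = 0 -> x = 0.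
Proof.
rewrite mxE => /eqP; rewrite psumr_eq0 => [/allP x0|i _]; last first.
  by rewrite mxE -expr2 sqr_ge0.
apply/colP => i; have := x0 i (mem_index_enum i).
by rewrite !mxE -expr2 sqrf_eq0 => /eqP.
Qed.

(** Perturbing [x] in the direction [V x] changes the form by
    [2 t |V x|^2 + O(t^2)], which would be negative for small negative [t] if
    [V x] were nonzero. *)
Lemma psd_qform_eq0 n (V : 'M[R]_n) (x : 'cV[R]_n) : psd V ->
  qform V x = 0 -> V *m x = 0.
Proof.
move=> [Vsym Vge0] x0; apply: dotmx_eq0.
set q := ((V *m x)^T *m (V *m x)) 0 0.
have q_ge0 : 0 <= q.
  by rewrite /q mxE sumr_ge0// => i _; rewrite mxE -expr2 sqr_ge0.
set c := qform V (V *m x); have c_ge0 : 0 <= c by exact: Vge0.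
have xVVx : (x^T *m (V *m (V *m x))) 0 0 = q.
  by rewrite /q trmx_mul Vsym mulmxA.
have ineq t : 0 <= t ^+ 2 * c + t * q *+ 2.
  have := Vge0 (x + t *: (V *m x)).
  rewrite -/(qform V _) qformD// x0 add0r qformZ -/c -!scalemxAr.
  by rewrite [X in X *+ 2]mxE xVVx.
apply: contrapT => /eqP q0.
have q_gt0 : 0 < q by rewrite lt_neqAle eq_sym q0.
have c1 : 0 < c + 1 by rewrite ltr_wpDl.
(* The minimizer would be [t = - q / c]; [c + 1] avoids a division by zero. *)
have := ineq (- (q / (c + 1))); rewrite leNgt => /negP; apply.
have -> : (- (q / (c + 1))) ^+ 2 * c + - (q / (c + 1)) * q *+ 2 =
   - ((q / (c + 1)) ^+ 2 * (c + 2)).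
  by field; rewrite gt_eqF.
by rewrite oppr_lt0 mulr_gt0// ?exprn_gt0 ?divr_gt0// ltr_wpDl.
Qed.

Lemma psd_mulmx_eq0 n m (V : 'M[R]_n) (X : 'M[R]_(n, m)) : psd V ->
  X^T *m V *m X = 0 -> V *m X = 0.
Proof.
move=> Vpsd XVX; apply/matrixP => i j.
have : V *m col j X = 0.
  apply: psd_qform_eq0 => //; rewrite /qform tr_col -row_mul.
  by rewrite -row_mul -col_mul XVX !mxE.
by rewrite -col_mul => /colP/(_ i); rewrite !mxE.
Qed.

Lemma psdZ n (V : 'M[R]_n) (a : R) : 0 <= a -> psd V -> psd (a *: V).
Proof.
move=> a0 [Vsym Vge0]; split; first by rewrite linearZ /= Vsym.
by move=> x; rewrite -scalemxAr -scalemxAl mxE mulr_ge0.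
Qed.

Lemma psd_trace_ge0 m n (V : 'M[R]_n) (M : 'M[R]_(m, n)) : psd V ->
  0 <= \tr (M *m V *m M^T).
Proof.
move=> [_ Vge0]; apply: sumr_ge0 => i _.
have := Vge0 (row i M)^T.
have -> : (row i M)^T^T *m V *m (row i M)^T = row i (col i (M *m V *m M^T)).
  by rewrite trmxK tr_row col_mul -!row_mul.
by rewrite !mxE.
Qed.

Lemma mxrangeP m n (V : 'M[R]_(m, n)) (y : 'cV[R]_m) :
  mxrange V y <-> (y^T <= V^T)%MS.
Proof.
split=> [[z _ <-]|/submxP[D yD]]; first by rewrite trmx_mul submxMl.
by exists D^T => //; rewrite -[RHS]trmxK yD trmx_mul !trmxK.
Qed.

End QuadraticForm.

(** * KKT pairs of the linear model *)

Section KKT.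
Context {R : realType} {n d : nat}.
Variables (Phi : 'M[R]_(n, d)).

(** Optimality conditions for minimizing [tr (K V K^T)] over the [K] with
    [K Phi = 1]; [S] is the Lagrange multiplier, up to a factor. *)
Definition kkt (V : 'M[R]_n) (K : 'M[R]_(d, n)) (S : 'M[R]_d) : Prop :=
  K *m Phi = 1%:M /\ K *m V = S *m Phi^T.

Lemma full_col_injective m (X : 'M[R]_(d, m)) : \rank Phi = d ->
  Phi *m X = 0 -> X = 0.
Proof.
move=> Phi_full PhiX.
apply: trmx_inj; rewrite trmx0; apply/eqP.
rewrite -(mulmx_free_eq0 _ (B := Phi^T)) -?trmx_mul ?PhiX ?trmx0//.
by rewrite /row_free mxrank_tr Phi_full.
Qed.

(** Solvability of the KKT system is tested on the kernel of its matrix,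
    spanned by the columns of [cokermx]. *)
Lemma kkt_exists (V : 'M[R]_n) : psd V -> \rank Phi = d ->
  exists K S, kkt V K S.
Proof.
move=> Vpsd Phi_full.
suff /submxP[D DE] : (row_mx (0 : 'M[R]_(d, n)) 1%:M <=
    block_mx V Phi Phi^T 0)%MS.
  exists (lsubmx D), (- rsubmx D).
  move: DE; rewrite -{1}[D]hsubmxK mul_row_block mulmx0 addr0.
  move=> /eq_row_mx[E1 E2]; split => //.
  by rewrite mulNmx; apply/eqP; rewrite -addr_eq0 -E1.
rewrite submxE; set C := cokermx _.
have := mulmx_coker (block_mx V Phi Phi^T 0); rewrite -/C.
rewrite -[C]vsubmxK mul_block_col mul_row_col !mul0mx add0r mul1mx addr0.
set X := usubmx C; set Y := dsubmx C.
rewrite -[0]vsubmxK !linear0 => /eq_col_mx[E1 E2].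
have VX : V *m X = 0.
  apply: psd_mulmx_eq0 => //.
  have := congr1 (mulmx X^T) E1; rewrite mulmxDr mulmx0 !mulmxA.
  by rewrite -[X^T *m Phi]trmxK trmx_mul trmxK E2 trmx0 mul0mx addr0.
apply/eqP; apply: full_col_injective => //.
by move: E1; rewrite VX add0r.
Qed.

Lemma kktZ (V : 'M[R]_n) K S (a : R) : kkt V K S -> kkt (a *: V) K (a *: S).
Proof. by move=> [K1 KV]; split => //; rewrite -scalemxAr KV scalemxAl. Qed.

(** The multiplier equation makes [D V K^T] vanish for every admissible
    variation [D], so the objective splits orthogonally. *)
Lemma kkt_trace_min (V : 'M[R]_n) K S (M : 'M[R]_(d, n)) : psd V ->
  kkt V K S -> M *m Phi = 1%:M ->
  \tr (K *m V *m K^T) <= \tr (M *m V *m M^T).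
Proof.
move=> Vpsd [K1 KV] M1; have [Vsym _] := Vpsd.
pose D := M - K; have -> : M = K + D by rewrite addrC subrK.
have D0 : D *m Phi = 0 by rewrite mulmxBl K1 M1 subrr.
have KVD : K *m V *m D^T = 0.
  by rewrite KV -mulmxA -trmx_mul D0 trmx0 mulmx0.
have DVK : D *m V *m K^T = 0.
  by apply: trmx_inj; rewrite !trmx_mul trmxK Vsym mulmxA KVD trmx0.
rewrite linearD /= mulmxDl mulmxDl mulmxDr KVD addr0 mulmxDr DVK add0r.
by rewrite linearD /= lerDl; exact: psd_trace_ge0.
Qed.

(** On the range of [V] the weighted norm can be computed without knowing the
    pseudoinverse, by [V V^+ V = V]. *)
Lemma wnorm_range (V : 'M[R]_n) (z : 'cV[R]_n) : psd V ->
  wnorm (mppinv V) (V *m z) ^+ 2 = qform V z.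
Proof.
move=> [Vsym Vge0]; have [VXV _ _ _] := mppinvP V.
rewrite /wnorm trmx_mul Vsym.
have -> : z^T *m V *m mppinv V *m (V *m z) = z^T *m V *m z.
  by rewrite -[in RHS]VXV !mulmxA.
by rewrite /mxtrace big_ord1 sqr_sqrtr.
Qed.

(** Feasibility of [K y] rests on [Phi K V = V K^T Phi^T]: the multiplier is
    [S = K V K^T], hence symmetric, and [Phi K V = Phi S Phi^T].  The second
    part is the normal equation. *)
Lemma feasible_residual (V : 'M[R]_n) K S (theta : 'cV[R]_d) (e : 'cV[R]_n) :
  V^T = V -> kkt V K S ->
  let y := Phi *m theta + V *m e in
  let z := e - K^T *m (Phi^T *m e) in
  y - Phi *m (K *m y) = V *m z /\ Phi^T *m z = 0.
Proof.
move=> Vsym [K1 KV] /=; split; last first.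
  by rewrite mulmxBr (mulmxA Phi^T) -trmx_mul K1 trmx1 mul1mx subrr.
have VK : V *m K^T = Phi *m S^T.
  by apply: trmx_inj; rewrite !trmx_mul !trmxK Vsym.
have SE : S = S^T.
  have : K *m V *m K^T = S by rewrite KV -mulmxA -trmx_mul K1 trmx1 mulmx1.
  by move <-; rewrite !trmx_mul trmxK Vsym mulmxA.
rewrite mulmxDr (mulmxA K Phi) K1 mul1mx mulmxDr opprD addrACA subrr add0r.
by rewrite mulmxBr (mulmxA V) VK -SE (mulmxA K) KV !mulmxA.
Qed.

(** Residuals [V z'] and [V z] of two parameters differ by a vector in the
    range of [Phi], and [z] is orthogonal to that range, so
    [z'^T V z' = z^T V z + (z' - z)^T V (z' - z)]. *)
Lemma wls_argmin_kkt (V : 'M[R]_n) K S (theta : 'cV[R]_d) (e : 'cV[R]_n) :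
  psd V -> \rank Phi = d -> kkt V K S ->
  let y := Phi *m theta + V *m e in wls_argmin Phi V y = [set K *m y].
Proof.
move=> Vpsd Phi_full Kkkt y; have [Vsym Vge0] := Vpsd.
have [yz Phiz] := feasible_residual theta e Vsym Kkkt.
rewrite -/y in yz; move: yz Phiz; move: (e - _) => z yz Phiz.
have key theta' z' : y - Phi *m theta' = V *m z' ->
    Phi *m (K *m y - theta') = V *m (z' - z) /\
    qform V z' = qform V z + qform V (z' - z).
  move=> yz'.
  have dE : Phi *m (K *m y - theta') = V *m (z' - z).
    by rewrite !mulmxBr -yz' -yz opprB [RHS]addrC subrKA.
  split=> //; rewrite -{1}(subrK z z') addrC qformD// -dE mulmxA.
  rewrite -[_^T *m Phi]trmxK trmx_mul trmxK Phiz trmx0 mul0mx mxE mul0rn.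
  by rewrite addr0.
apply/seteqP; split=> [t [[z' _ yz'] tmin]|t ->].
- have [dE qE] := key _ _ (esym yz').
  have : feasible Phi V y (K *m y) by exists z.
  move/tmin; rewrite -yz' yz !wnorm_range// qE gerDl => qle0.
  have /psd_qform_eq0 : qform V (z' - z) = 0.
    by apply/eqP; rewrite eq_le qle0; exact: Vge0.
  move/(_ Vpsd); rewrite -dE => /(full_col_injective Phi_full)/eqP.
  by rewrite subr_eq0 => /eqP <-.
- split; first by exists z.
  move=> theta' [z' _ yz']; have [_ qE] := key _ _ (esym yz').
  by rewrite -yz' yz !wnorm_range// qE lerDl; exact: Vge0.
Qed.

(** Feasible data are those in the sum of the ranges of [Phi] and [V]; with the
    default value elsewhere this describes the estimator everywhere, in a form
    from which its measurability can be read off. *)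
Lemma wls_kktE (V : 'M[R]_n) K S (y : 'cV[R]_n) :
  psd V -> \rank Phi = d -> kkt V K S ->
  wls Phi V y = if y^T *m cokermx (col_mx Phi^T V) == 0 then K *m y else 0.
Proof.
move=> Vpsd Phi_full Kkkt; have [Vsym _] := Vpsd.
rewrite -submxE; case: ifPn => [|yN].
  move/submxP => [D yD].
  have -> : y = Phi *m (lsubmx D)^T + V *m (rsubmx D)^T.
    rewrite -[LHS]trmxK yD -{1}[D]hsubmxK mul_row_col linearD /=.
    by rewrite !trmx_mul trmxK Vsym.
  rewrite /wls (wls_argmin_kkt _ _ Vpsd Phi_full Kkkt).
  by apply: xget_unique.
rewrite /wls xgetPN// => t [[z _ yz] _]; move/negP: yN; apply.
have -> : y = Phi *m t + V *m z by rewrite yz addrC subrK.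
rewrite linearD /= !trmx_mul Vsym -mul_row_col; exact: submxMl.
Qed.

End KKT.

(** * Moments and support of the noise *)

Lemma norm2_sqr (R : realType) n (x : 'cV[R]_n) :
  norm2 x ^+ 2 = \sum_i x i 0 ^+ 2.
Proof. by rewrite sqr_sqrtr// sumr_ge0// => i _; exact: sqr_ge0. Qed.

Lemma norm2N (R : realType) n (x : 'cV[R]_n) : norm2 (- x) = norm2 x.
Proof. by congr Num.sqrt; apply: eq_bigr => i _; rewrite mxE sqrrN. Qed.

Lemma norm2_sqr_eq0 (R : realType) n (x : 'cV[R]_n) :
  (norm2 x ^+ 2 == 0) = (x == 0).
Proof.
apply/eqP/eqP => [x0|->]; last first.
  by rewrite norm2_sqr big1// => i _; rewrite mxE expr0n.
apply: dotmx_eq0; rewrite -{}x0 norm2_sqr mxE.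
by apply: eq_bigr => i _; rewrite mxE expr2.
Qed.

Section Noise.
Context {R : realType} {n : nat} {disp : measure_display}
  {T : measurableType disp}.
Variables (P : probability T R) (eps : 'I_n -> {RV P >-> R}).

Definition noise (w : T) : 'cV[R]_n := \col_i eps i w.

Lemma noise_mulE m (M : 'M[R]_(m, n)) a :
  (fun w => (M *m noise w) a 0) = \sum_i (fun w => eps i w * M a i).
Proof.
apply/funext => w; rewrite fct_sumE mxE.
by apply: eq_bigr => i _; rewrite mxE mulrC.
Qed.

Lemma measurable_noise_mul m (M : 'M[R]_(m, n)) a :
  measurable_fun setT (fun w => (M *m noise w) a 0).
Proof.
under eq_fun do rewrite mxE; apply: measurable_sum => i.
under eq_fun do rewrite [X in _ * X]mxE.
exact: measurable_funM.
Qed.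

Lemma measurable_norm2_affine m (M : 'M[R]_(m, n)) (c : 'cV[R]_m) :
  measurable_fun setT (fun w => norm2 (c + M *m noise w) ^+ 2).
Proof.
under eq_fun do rewrite norm2_sqr.
apply: measurable_sum => a; apply: measurable_funX.
under eq_fun do rewrite mxE.
by apply: measurable_funD => //; exact: measurable_noise_mul.
Qed.

Hypothesis eps_L2 : forall i, (eps i : T -> R) \in Lfun P 2%:E.

Lemma eps_L1 i : (eps i : T -> R) \in Lfun P 1.
Proof. by apply: Lfun_subset12 => //; exact: fin_num_measure. Qed.

Lemma expectation_sum_ord m (X : 'I_m -> T -> R) :
  (forall i, X i \in Lfun P 1) ->
  ('E_P[\sum_i X i] = \sum_i 'E_P[X i])%E.
Proof.
move=> XL1; rewrite unlock -integral_sum//; last first.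
  by move=> i; apply/Lfun1_integrable; exact: XL1.
by apply: eq_integral => w _; rewrite fct_sumE sumEFin.
Qed.

Lemma noise_mul_L1 m (M : 'M[R]_(m, n)) a :
  (fun w => (M *m noise w) a 0) \in Lfun P 1.
Proof.
rewrite noise_mulE; apply: rpred_sum => i _.
exact: Lfun_scale (eps_L1 i).
Qed.

Hypothesis eps_mean : forall i, ('E_P[eps i] = 0)%E.

Lemma expectation_noise_mul m (M : 'M[R]_(m, n)) a :
  ('E_P[fun w => (M *m noise w)%R a ord0] = 0)%E.
Proof.
rewrite noise_mulE expectation_sum_ord => [|i]; last first.
  exact: Lfun_scale (eps_L1 i).
rewrite big1// => i _; rewrite (expectationZl (M a i) (eps_L1 i)).
by rewrite eps_mean mule0.
Qed.

Lemma expectation_affine m (M : 'M[R]_(m, n)) (c : 'cV[R]_m) a :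
  ('E_P[fun w => (c + M *m noise w)%R a ord0] = (c a ord0)%:E)%E.
Proof.
have -> : (fun w => (c + M *m noise w)%R a ord0) =
    cst (c a 0) \+ (fun w => (M *m noise w) a 0).
  by apply/funext => w; rewrite mxE.
rewrite expectationD; [|exact: Lfun_cst|exact: noise_mul_L1].
by rewrite expectation_cst expectation_noise_mul adde0.
Qed.

Variable V : 'M[R]_n.
Hypothesis eps_cov : forall i j, covariance P (eps i) (eps j) = (V i j)%:E.

Lemma expectation_noise_mul_sqr m (M : 'M[R]_(m, n)) a :
  ('E_P[fun w => ((M *m noise w) a ord0 ^+ 2)%R] = ((M *m V *m M^T) a a)%:E)%E.
Proof.
have epsM i j : (eps i : T -> R) * (eps j : T -> R) \in Lfun P 1.
  exact: Lfun2_mul_Lfun1.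
have epsE i j : ('E_P[(eps i : T -> R) * (eps j : T -> R)] = (V i j)%:E)%E.
  rewrite -eps_cov covarianceE ?eps_L1//.
  by rewrite !eps_mean mule0 sube0.
have -> : (fun w => ((M *m noise w) a ord0 ^+ 2)) =
    \sum_(i < n) \sum_(j < n)
      ((M a i * M a j) \o* ((eps i : T -> R) * (eps j : T -> R))).
  apply/funext => w; rewrite fct_sumE expr2 !mxE mulr_suml.
  apply: eq_bigr => i _; rewrite fct_sumE mulr_sumr; apply: eq_bigr => j _ /=.
  by rewrite !mxE !fctE; ring.
rewrite expectation_sum_ord => [|i]; last first.
  by apply: rpred_sum => j _; exact: Lfun_scale.
under eq_bigr => i _.
  rewrite expectation_sum_ord => [|j]; last exact: Lfun_scale.
  under eq_bigr => j _ do rewrite expectationZl ?epsM// epsE -EFinM.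
  rewrite sumEFin; over.
rewrite sumEFin exchange_big mxE; congr EFin; apply: eq_bigr => j _.
rewrite !mxE mulr_suml; apply: eq_bigr => i _; ring.
Qed.

Lemma expectation_norm2_noise m (M : 'M[R]_(m, n)) :
  ('E_P[fun w => (norm2 (M *m noise w) ^+ 2)%R] = (\tr (M *m V *m M^T))%:E)%E.
Proof.
under eq_fun do rewrite norm2_sqr.
transitivity (\sum_(a < m) 'E_P[fun w => ((M *m noise w) a ord0 ^+ 2)%R])%E.
  rewrite unlock; under eq_integral do rewrite -sumEFin.
  rewrite ge0_integral_sum// => a; first last.
    by move=> w _; rewrite lee_fin sqr_ge0.
  by apply/measurable_EFinP/measurable_funX; exact: measurable_noise_mul.
by under eq_bigr do rewrite expectation_noise_mul_sqr; rewrite sumEFin.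
Qed.

(** With [C] spanning the kernel of [V], the vector [C^T noise] has vanishing
    second moment, hence vanishes almost surely; since [V] is symmetric this
    puts the noise in the range of [V]. *)
Lemma noise_range_ae : psd V -> {ae P, forall w, mxrange V (noise w)}.
Proof.
move=> [Vsym _].
set C := cokermx V.
have mC : measurable_fun setT (fun w => (norm2 (C^T *m noise w) ^+ 2)%:E).
  apply/measurable_EFinP.
  by have := measurable_norm2_affine C^T 0; under eq_fun do rewrite add0r.
have [+ _] := ae_eq_integral_abs P measurableT mC.
have -> : (\int[P]_w `|(norm2 (C^T *m noise w) ^+ 2)%:E| = 0)%E.
  under eq_integral do rewrite gee0_abs ?lee_fin ?sqr_ge0//.
  have := expectation_norm2_noise C^T; rewrite unlock => ->.
  by rewrite trmxK -mulmxA mulmx_coker mulmx0 mxtrace0.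
move=> /(_ erefl); apply: filterS => w /(_ I)[] /eqP.
rewrite norm2_sqr_eq0 => /eqP Cw; apply/mxrangeP.
by rewrite Vsym submxE -/C -[C]trmxK -trmx_mul Cw trmx0.
Qed.

End Noise.

(** * Comparison of the estimators *)

Section GaussMarkov.
Context {R : realType} {n d : nat} {disp : measure_display}
  {T : measurableType disp}.
Variables (P : probability T R) (eps : 'I_n -> {RV P >-> R}).
Hypothesis eps_L2 : forall i, (eps i : T -> R) \in Lfun P 2%:E.
Hypothesis eps_mean : forall i, ('E_P[eps i] = 0)%E.
Variable V : 'M[R]_n.
Hypothesis eps_cov : forall i j, covariance P (eps i) (eps j) = (V i j)%:E.
Variable Phi : 'M[R]_(n, d).

(** The mean of [K y] is [K Phi theta]; testing it on the unit vectors [theta]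
    gives the columns of [K Phi]. *)
Lemma unbiasedP (K : 'M[R]_(d, n)) :
  unbiased Phi eps (mulmx K) <-> K *m Phi = 1%:M.
Proof.
have EK theta i : ('E_P[fun w => (K *m observation Phi eps theta w)%R i ord0] =
    ((K *m Phi *m theta) i ord0)%:E)%E.
  rewrite -(expectation_affine eps_L2 eps_mean K).
  by congr expectation; apply/funext => w; rewrite mulmxDr mulmxA.
split=> [Kunb|K1 theta i]; last by rewrite EK K1 mul1mx.
apply/matrixP => i j; have := Kunb (delta_mx j 0) i.
rewrite EK => -[]; rewrite -colE -[in X in _ = X -> _](mul1mx (delta_mx j 0)).
by rewrite -colE !mxE.
Qed.

Lemma mse_linear (K : 'M[R]_(d, n)) theta : K *m Phi = 1%:M ->
  mse Phi eps (mulmx K) theta = (\tr (K *m V *m K^T))%:E.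
Proof.
move=> K1; rewrite -(expectation_norm2_noise eps_L2 eps_mean eps_cov).
congr expectation; apply/funext => w; congr (_ ^+ 2).
rewrite mulmxDr mulmxA K1 mul1mx opprD addrA subrr add0r.
exact: norm2N.
Qed.

Lemma wls_argmin_ae K S (theta : 'cV[R]_d) (alpha : R) :
  psd V -> 0 < alpha -> \rank Phi = d -> kkt Phi V K S ->
  {ae P, forall w, wls_argmin Phi (alpha *: V) (observation Phi eps theta w) =
    [set K *m observation Phi eps theta w]}.
Proof.
move=> Vpsd alpha_gt0 Phi_full Kkkt.
have := noise_range_ae eps_L2 eps_mean eps_cov Vpsd.
apply: filterS => w [e _ eE].
have -> : observation Phi eps theta w =
    Phi *m theta + (alpha *: V) *m (alpha^-1 *: e).
  by rewrite -scalemxAl -scalemxAr scalerA divff ?gt_eqF// scale1r eE.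
by apply: wls_argmin_kkt (kktZ _ Kkkt) => //; apply: psdZ => //; exact: ltW.
Qed.

(** Both estimators agree almost surely by [wls_argmin_ae].  Almost sure
    equality transfers to the integrals only for measurable functions, and
    [wls_kktE] provides the measurability of the least squares error: the
    feasibility test is the vanishing of a measurable norm. *)
Lemma mse_wls K S (theta : 'cV[R]_d) (alpha : R) :
  psd V -> 0 < alpha -> \rank Phi = d -> kkt Phi V K S ->
  mse Phi eps (wls Phi (alpha *: V)) theta = mse Phi eps (mulmx K) theta.
Proof.
move=> Vpsd alpha_gt0 Phi_full Kkkt.
have mK : measurable_fun setT
    (fun w => norm2 (theta - K *m observation Phi eps theta w) ^+ 2).
  have := measurable_norm2_affine eps (- K) (theta - K *m (Phi *m theta)).
  by under eq_fun do rewrite mulNmx -addrA -opprD -mulmxDr.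
rewrite /mse unlock; apply: ae_eq_integral => //.
- apply/measurable_EFinP.
  have alphaVpsd : psd (alpha *: V) by apply: psdZ => //; exact: ltW.
  under eq_fun do rewrite (wls_kktE _ alphaVpsd Phi_full (kktZ alpha Kkkt)).
  set C := cokermx _.
  have -> : (fun w => norm2 (theta -
      (if (observation Phi eps theta w)^T *m C == 0
      then K *m observation Phi eps theta w else 0)) ^+ 2) =
    (fun w => if norm2 (C^T *m Phi *m theta + C^T *m noise eps w) ^+ 2 == 0
     then norm2 (theta - K *m observation Phi eps theta w) ^+ 2
     else norm2 theta ^+ 2).
    apply/funext => w.
    rewrite -mulmxA -mulmxDr -/(observation Phi eps theta w).
    rewrite norm2_sqr_eq0 -[X in _ = if X == _ then _ else _]trmxK.
    rewrite trmx_mul trmxK trmx_eq0.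
    by case: ifP => // _; rewrite subr0.
  apply: measurable_fun_ifT => //.
  apply: measurable_fun_eqr => //.
  exact: measurable_norm2_affine.
- exact/measurable_EFinP.
- have := wls_argmin_ae theta Vpsd alpha_gt0 Phi_full Kkkt.
  apply: filterS => w wE _; rewrite /wls wE; congr ((norm2 (_ - _) ^+ 2)%:E).
  exact: xget_unique.
Qed.

End GaussMarkov.

Theorem theorem1 (R : realType) (n d : nat)
    (disp : measure_display) (T : measurableType disp) (P : probability T R)
    (Phi : 'M[R]_(n, d)) (V0 : 'M[R]_n) (eps : 'I_n -> {RV P >-> R})
    (V0_psd : psd V0)
    (eps_L2 : forall i, (eps i : T -> R) \in Lfun P 2%:E)
    (eps_mean : forall i, ('E_P[eps i] = 0)%E)
    (eps_cov : forall i j, covariance P (eps i) (eps j) = (V0 i j)%:E)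
    (Phi_full : \rank Phi = d)
    (alpha : R) (alpha_gt0 : 0 < alpha) :
  (exists K : 'M[R]_(d, n),
      unbiased Phi eps (mulmx K) /\
      forall theta0 : 'cV[R]_d,
        {ae P, forall w,
          wls_argmin Phi (alpha *: V0) (observation Phi eps theta0 w) =
          [set K *m observation Phi eps theta0 w]})
  /\
  (forall K : 'M[R]_(d, n), unbiased Phi eps (mulmx K) ->
      forall theta0 : 'cV[R]_d,
        (mse Phi eps (wls Phi (alpha *: V0)%R) theta0
           <= mse Phi eps (mulmx K) theta0)%E).
Proof.
have [K0 [S K0kkt]] := kkt_exists V0_psd Phi_full; have [K01 _] := K0kkt.
split=> [|K /(unbiasedP eps_L2 eps_mean) K1 theta0].
  exists K0; split; first exact/unbiasedP.
  by move=> theta0; apply: wls_argmin_ae K0kkt.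
rewrite (mse_wls eps_L2 eps_mean eps_cov _ V0_psd alpha_gt0 Phi_full K0kkt).
rewrite !(mse_linear eps_L2 eps_mean eps_cov)// lee_fin.
exact: kkt_trace_min K0kkt K1.
Qed.
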